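(* Let $U,V\in\mathrm{SpSt}(2n,2k)$. If $(I_{2k}+U^+V)^{-1}$ and $(I_{2k}+V^+U)^{-1}$ exist, then for $$A=2\left((I_{2k}+V^+U)^{-1}-(I_{2k}+U^+V)^{-1}\right)\in\mathfrak{sp}(2k,\mathbb{R})$$ and $$H=2\left((V+U)(I_{2k}+U^+V)^{-1}-U\right)\in\mathrm{Hor}^{\rho,h}_U\mathrm{SpSt}(2n,2k),$$ it holds that $\mathcal{L}^{\mathrm{SpSt}}_U(V):=UA+H\in T_U\mathrm{SpSt}(2n,2k)$ fulfills $\mathcal{R}^{\mathrm{SpSt}}_U\big(\mathcal{L}^{\mathrm{SpSt}}_U(V)\big)=V$.
   Context: Let $k\le n$ be positive integers, $J_{2m}=\begin{bmatrix}0&I_m\\-I_m&0\end{bmatrix}$, and for a real $2a\times 2b$ matrix $A$ put $A^+:=J_{2b}^TA^TJ_{2a}$. $\mathfrak{sp}(2k,\mathbb{R})=\{\Omega\in\mathbb{R}^{2k\times2k}:\Omega^+=-\Omega\}$. $\mathrm{SpSt}(2n,2k)=\{U\in\mathbb{R}^{2n\times2k}:U^+U=I_{2k}\}$ with $T_U\mathrm{SpSt}(2n,2k)=\{\Delta\in\mathbb{R}^{2n\times2k}: U^+\Delta\in\mathfrak{sp}(2k,\mathbb{R})\}$. $\mathrm{Hor}^{\rho,h}_U\mathrm{SpSt}(2n,2k)=\{\Delta\in\mathbb{R}^{2n\times2k}:U^+\Delta=0\}$. The Cayley transform is $\mathrm{cay}(X)=(I+X)(I-X)^{-1}$. The Cayley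 retraction on $\mathrm{SpSt}(2n,2k)$ is $\mathcal{R}^{\mathrm{SpSt}}_U(\Delta)=\mathrm{cay}\left(\frac12\tilde\Omega(U,\Delta)\right)U$, where $\tilde\Omega(U,\Delta)=\left(I_{2n}-\frac12UU^+\right)\Delta U^+-U\Delta^+\left(I_{2n}-\frac12UU^+\right)$. *)

(* Defs.v *)
From mathcomp Require Import all_boot all_order all_algebra.
From mathcomp Require Import classical_sets reals.

Set Implicit Arguments.
Unset Strict Implicit.
Unset Printing Implicit Defensive.

Import GRing.Theory Num.Theory.
Local Open Scope ring_scope.
Local Open Scope classical_set_scope.

(* Dimensions 2m are written m + m, so that the m x m blocks of a matrix are
   available through [block_mx]. *)

Definition Jmx (R : realType) (m : nat) : 'M[R]_(m + m) :=
  block_mx 0 1%:M (- 1%:M) 0.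

Definition sympl_adj (R : realType) (a b : nat) (A : 'M[R]_(a + a, b + b)) :
    'M[R]_(b + b, a + a) :=
  (Jmx R b)^T *m A^T *m Jmx R a.

Definition sp (R : realType) (k : nat) : set 'M[R]_(k + k) :=
  [set Omega | sympl_adj Omega = - Omega].

Definition SpSt (R : realType) (n k : nat) : set 'M[R]_(n + n, k + k) :=
  [set U | sympl_adj U *m U = 1%:M].

(* T_U SpSt(2n, 2k), meaningful only for U in SpSt(2n, 2k). *)
Definition TSpSt (R : realType) (n k : nat) (U : 'M[R]_(n + n, k + k)) :
    set 'M[R]_(n + n, k + k) :=
  [set Delta | sp (sympl_adj U *m Delta)].

(* Hor^{rho,h}_U SpSt(2n, 2k). *)
Definition HorSpSt (R : realType) (n k : nat) (U : 'M[R]_(n + n, k + k)) :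
    set 'M[R]_(n + n, k + k) :=
  [set Delta | sympl_adj U *m Delta = 0].

(* [invmx] is total (the identity on singular matrices), so [cay X] is the
   Cayley transform only when [cay_defined X] holds. *)
Definition cay_defined (R : realType) (m : nat) (X : 'M[R]_m) : Prop :=
  1%:M - X \in unitmx.

Definition cay (R : realType) (m : nat) (X : 'M[R]_m) : 'M[R]_m :=
  (1%:M + X) *m invmx (1%:M - X).

Definition tildeOmega (R : realType) (n k : nat)
    (U Delta : 'M[R]_(n + n, k + k)) : 'M[R]_(n + n) :=
  let P := 1%:M - 2^-1 *: (U *m sympl_adj U) in
  P *m Delta *m sympl_adj U - U *m sympl_adj Delta *m P.

Definition retr_defined (R : realType) (n k : nat)
    (U Delta : 'M[R]_(n + n, k + k)) : Prop :=
  cay_defined (2^-1 *: tildeOmega U Delta).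

Definition retr (R : realType) (n k : nat)
    (U Delta : 'M[R]_(n + n, k + k)) : 'M[R]_(n + n, k + k) :=
  cay (2^-1 *: tildeOmega U Delta) *m U.

(* Main.v *)
Require Import Defs.
From mathcomp Require Import all_boot all_order all_algebra.
From mathcomp Require Import classical_sets reals.

(** Write [U^+] for [sympl_adj U] and put [M = 1 + U^+ V], so that
    [M^+ = 1 + V^+ U]. The proof rests on replacing [H] by the point
    [K = U + H/2 = (V + U) M^-1] of the affine space [U^+ K = 1]; horizontality
    of [H] is exactly this normalisation. With [C = A/2 = (M^+)^-1 - M^-1], the
    argument of the Cayley transform becomes
      [X = K U^+ - U K^+ + U C U^+]
    (lemma [half_tildeOmega]).

    From [U^+ K = 1] one reads off how [X] acts on [K],
      [(1 - X) K = U (K^+ K - C)]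
    (lemma [cay_arg_mulK]). The right-hand factor is the only obstruction to
    inverting [1 - X]: a fixed vector [w] of [X] has the form [K a], whence
    [(K^+ K - C) a = 0] (lemma [cay_arg_unit]). For the data at hand,
    [K^+ K = M^-1 + (M^+)^-1], because [(V + U)^+ (V + U) = M + M^+]. Hence
    [K^+ K - C = 2 M^-1], which is invertible. Moreover
    [X K = K - 2 U M^-1]; multiplying by [M] on the right gives
    [X (V + U) = V - U], that is [(1 + X) U = (1 - X) V], and this says that the
    Cayley transform of [X] sends [U] to [V] (lemma [cay_mul_eq]). *)

Set Implicit Arguments.
Unset Strict Implicit.
Unset Printing Implicit Defensive.

Import GRing.Theory Num.Theory.
Local Open Scope ring_scope.

Lemma Jmx_trE (R : realType) (m : nat) : (Jmx R m)^T = - Jmx R m.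
Proof.
by rewrite /Jmx tr_block_mx opp_block_mx linearN /= !trmx0 !trmx1 !oppr0 opprK.
Qed.

Lemma Jmx_sqr (R : realType) (m : nat) : Jmx R m *m Jmx R m = - 1%:M.
Proof.
rewrite /Jmx mulmx_block !mul0mx !mulmx0 !mul1mx !mulmx1 !addr0 !add0r.
by rewrite (@scalar_mx_block R m m 1) opp_block_mx oppr0.
Qed.

Lemma sympl_adj1 (R : realType) (m : nat) :
  sympl_adj (1%:M : 'M[R]_(m + m)) = 1%:M.
Proof. by rewrite /sympl_adj trmx1 mulmx1 Jmx_trE mulNmx Jmx_sqr opprK. Qed.

Lemma sympl_adjD (R : realType) (a b : nat) (A B : 'M[R]_(a + a, b + b)) :
  sympl_adj (A + B) = sympl_adj A + sympl_adj B.
Proof. by rewrite /sympl_adj linearD mulmxDr mulmxDl. Qed.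

Lemma sympl_adjZ (R : realType) (a b : nat) (c : R)
    (A : 'M[R]_(a + a, b + b)) :
  sympl_adj (c *: A) = c *: sympl_adj A.
Proof. by rewrite /sympl_adj linearZ /= -scalemxAr -scalemxAl. Qed.

Lemma sympl_adjB (R : realType) (a b : nat) (A B : 'M[R]_(a + a, b + b)) :
  sympl_adj (A - B) = sympl_adj A - sympl_adj B.
Proof. by rewrite -scaleN1r sympl_adjD sympl_adjZ scaleN1r. Qed.

Lemma sympl_adjM (R : realType) (a b c : nat)
    (A : 'M[R]_(a + a, b + b)) (B : 'M[R]_(b + b, c + c)) :
  sympl_adj (A *m B) = sympl_adj B *m sympl_adj A.
Proof.
rewrite /sympl_adj trmx_mul !mulmxA; congr (_ *m _ *m _).
by rewrite -mulmxA (Jmx_trE R b) mulmxN Jmx_sqr opprK mulmx1.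
Qed.

Lemma sympl_adjK (R : realType) (a b : nat) (A : 'M[R]_(a + a, b + b)) :
  sympl_adj (sympl_adj A) = A.
Proof.
rewrite /sympl_adj !trmx_mul !trmxK !mulmxA !Jmx_trE !(mulNmx, mulmxN) opprK.
by rewrite -mulmxA !Jmx_sqr mulmxN mulmx1 mulNmx mul1mx opprK.
Qed.

Lemma sympl_adj_inv (R : realType) (m : nat) (A : 'M[R]_(m + m)) :
  A \in unitmx -> sympl_adj A \in unitmx ->
  sympl_adj (invmx A) = invmx (sympl_adj A).
Proof.
move=> uA uA'; rewrite -[LHS]mulmx1 -(mulmxV uA') mulmxA -sympl_adjM.
by rewrite mulmxV // sympl_adj1 mul1mx.
Qed.

(** The value of half of [tildeOmega] in the coordinates [K = U + H/2],
    [C = A/2] of a tangent vector [U A + H]. Compared with [H], the matrix [K]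
    shares with [U] the normalisation [U^+ K = 1]. *)
Definition cay_arg (R : realType) (n k : nat)
    (U K : 'M[R]_(n + n, k + k)) (C : 'M[R]_(k + k)) : 'M[R]_(n + n) :=
  K *m sympl_adj U - U *m sympl_adj K + U *m C *m sympl_adj U.

(** The self-adjoint matrix [P = 1 - U U^+ / 2] halves the vertical part [U A] and
    fixes the horizontal part [H], so [tildeOmega] is [E U^+ - U E^+] with
    [E = U A / 2 + H]. The two vertical terms of this difference then coincide,
    because [A] is anti-self-adjoint. *)
Lemma half_tildeOmega (R : realType) (n k : nat)
    (U H : 'M[R]_(n + n, k + k)) (A : 'M[R]_(k + k)) :
  SpSt U -> sp A -> HorSpSt U H ->
  2^-1 *: tildeOmega U (U *m A + H) =
    cay_arg U (U + 2^-1 *: H) (2^-1 *: A).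
Proof.
rewrite /SpSt /sp /HorSpSt /= => UU spA UH.
rewrite /tildeOmega; set P := 1%:M - _.
have adjP : sympl_adj P = P.
  by rewrite sympl_adjB sympl_adj1 sympl_adjZ sympl_adjM sympl_adjK.
have half (p q : nat) (W : 'M[R]_(p, q)) : W = 2^-1 *: W + 2^-1 *: W.
  by rewrite -scalerDl -[2^-1]mul1r -splitr scale1r.
have PD : P *m (U *m A + H) = 2^-1 *: (U *m A) + H.
  (* [U^+] is made abstract because it is itself a product, which
     reassociation would break up. *)
  rewrite /P; move: (sympl_adj U) UU UH => U' UU UH.
  rewrite mulmxBl mul1mx -scalemxAl mulmxDr -!mulmxA UH mulmx0 addr0.
  rewrite (mulmxA U' U) UU mul1mx addrAC; congr (_ + _).
  by rewrite {1}(half _ _ (U *m A)) addrK.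
have DP : sympl_adj (U *m A + H) *m P = sympl_adj (P *m (U *m A + H)).
  by rewrite sympl_adjM adjP.
rewrite -(mulmxA U) DP PD sympl_adjD sympl_adjZ sympl_adjM spA.
rewrite /cay_arg sympl_adjD sympl_adjZ mulNmx scalerN.
rewrite !mulmxDl !mulmxDr mulmxN.
move: (sympl_adj U) (sympl_adj H) => U' H'.
rewrite -!(scalemxAl, scalemxAr) !mulmxA.
set W := 2^-1 *: (U *m A *m U').
rewrite !opprD opprK addrACA scalerDr (scalerDr _ W W) -half scalerBr.
by rewrite addrACA subrr add0r; apply: addrC.
Qed.

(** Each of the three terms of [cay_arg] meets [U^+ K = 1] or [K^+ K], so the
    column space of [K] is mapped into itself up to a correction along [U]. *)
Lemma cay_arg_mulK (R : realType) (n k : nat)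
    (U K : 'M[R]_(n + n, k + k)) (C : 'M[R]_(k + k)) :
  sympl_adj U *m K = 1%:M ->
  cay_arg U K C *m K = K - U *m (sympl_adj K *m K - C).
Proof.
move=> UK; rewrite /cay_arg; move: (sympl_adj U) (sympl_adj K) UK => U' K' UK.
rewrite mulmxDl mulmxBl -!mulmxA UK !mulmx1.
by rewrite mulmxBr opprB addrA addrAC.
Qed.

(** If [X w = w] and [a = U^+ w], then applying [U^+] to [X w = w] turns this
    equation into [w = K a]; the action of [X] on [K] then leaves
    [U (K^+ K - C) a = 0], and [U] has the left inverse [U^+]. *)
Lemma cay_arg_unit (R : realType) (n k : nat)
    (U K : 'M[R]_(n + n, k + k)) (C : 'M[R]_(k + k)) :
  SpSt U -> sympl_adj U *m K = 1%:M ->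
  sympl_adj K *m K - C \in unitmx -> cay_defined (cay_arg U K C).
Proof.
rewrite /SpSt /= => UU UK unitD; rewrite /cay_defined -unitmx_tr -row_free_unit.
(* A row vector killed by the transpose of [1 - X] is a column vector [w] in
   the kernel of [1 - X]. *)
apply: inj_row_free => v v0; apply: trmx_inj; rewrite trmx0.
set w := v^T; set X := cay_arg U K C.
have Xw : X *m w = w.
  apply/esym/eqP; rewrite -subr_eq0 -[X in X - _]mul1mx -mulmxBl.
  by rewrite -[_ *m w]trmxK trmx_mul trmxK v0 trmx0.
pose a := sympl_adj U *m w.
have XwE : X *m w = K *m a + U *m (C *m a - sympl_adj K *m w).
  rewrite /X /a /cay_arg; move: (sympl_adj U) (sympl_adj K) => U' K'.
  by rewrite mulmxDl mulmxBl mulmxBr -!mulmxA -addrA [- _ + _]addrC.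
have wE : w = K *m a.
  have aE : sympl_adj U *m (X *m w) = a by rewrite Xw.
  rewrite -{1}Xw; move: aE; rewrite XwE; move: (C *m a - _) => z.
  rewrite mulmxDr (mulmxA _ K a) (mulmxA _ U z) UK UU !mul1mx.
  by rewrite -[RHS]addr0 => /addrI ->; rewrite mulmx0 addr0.
have : U *m ((sympl_adj K *m K - C) *m a) = 0.
  apply: oppr_inj; apply: (addrI (K *m a)); rewrite oppr0 addr0.
  by rewrite mulmxA -mulmxBl -cay_arg_mulK // -mulmxA -wE.
move/(congr1 (mulmx (sympl_adj U))); rewrite mulmxA UU mul1mx mulmx0.
move/(congr1 (mulmx (invmx (sympl_adj K *m K - C)))).
by rewrite mulKmx // mulmx0 wE => ->; rewrite mulmx0.
Qed.

(** The two factors of [cay X] commute, and the hypothesis on [V + U]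
    says that [(1 + X) U = (1 - X) V]. *)
Lemma cay_mul_eq (R : realType) (m p : nat) (X : 'M[R]_m)
    (U V : 'M[R]_(m, p)) :
  cay_defined X -> X *m (V + U) = V - U -> cay X *m U = V.
Proof.
rewrite /cay_defined /cay => unitX XVU.
have -> : (1%:M + X) *m invmx (1%:M - X) = invmx (1%:M - X) *m (1%:M + X).
  apply: (can_inj (mulKmx unitX)); rewrite (mulKVmx unitX) mulmxA.
  apply: (can_inj (mulmxK unitX)); rewrite (mulmxKV unitX).
  rewrite !(mulmxBl, mulmxBr, mulmxDl, mulmxDr) !mul1mx !mulmx1.
  by rewrite addrC opprD !addrA addrAC.
apply: (can_inj (mulKmx unitX)); rewrite -mulmxA (mulKVmx unitX).
rewrite mulmxDl mulmxBl !mul1mx; apply/eqP.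
by rewrite eq_sym subr_eq -addrA -mulmxDr [U + V]addrC XVU addrC subrK.
Qed.

Theorem proposition5p3 (R : realType) (n k : nat)
    (k_gt0 : (0 < k)%N) (le_kn : (k <= n)%N)
    (U V : 'M[R]_(n + n, k + k)) (SpStU : SpSt U) (SpStV : SpSt V)
    (unitUV : 1%:M + sympl_adj U *m V \in unitmx)
    (unitVU : 1%:M + sympl_adj V *m U \in unitmx) :
  let A : 'M[R]_(k + k) :=
    2 *: (invmx (1%:M + sympl_adj V *m U) - invmx (1%:M + sympl_adj U *m V)) in
  let H : 'M[R]_(n + n, k + k) :=
    2 *: ((V + U) *m invmx (1%:M + sympl_adj U *m V) - U) in
  let L : 'M[R]_(n + n, k + k) := U *m A + H in
  [/\ sp A, HorSpSt U H, TSpSt U L, retr_defined U L & retr U L = V].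
Proof.
move=> A H L.
have UU : sympl_adj U *m U = 1%:M := SpStU.
have VV : sympl_adj V *m V = 1%:M := SpStV.
set M := 1%:M + sympl_adj U *m V in unitUV A H L *.
have adjM : sympl_adj M = 1%:M + sympl_adj V *m U.
  by rewrite sympl_adjD sympl_adj1 sympl_adjM sympl_adjK.
rewrite -adjM in unitVU A L *.
set N := sympl_adj M in adjM unitVU A L *.
have adjiM : sympl_adj (invmx M) = invmx N by apply: sympl_adj_inv.
have adjiN : sympl_adj (invmx N) = invmx M by rewrite -adjiM sympl_adjK.
have two_neq0 : (2 : R) != 0 by rewrite pnatr_eq0.
pose K := (V + U) *m invmx M.
have US : sympl_adj U *m (V + U) = M by rewrite mulmxDr UU addrC.
have UK : sympl_adj U *m K = 1%:M by rewrite mulmxA US mulmxV.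
have KK : sympl_adj K *m K = invmx M + invmx N.
  have SS : sympl_adj (V + U) *m (V + U) = M + N.
    by rewrite sympl_adjD mulmxDl US mulmxDr VV -adjM addrC.
  rewrite /K sympl_adjM adjiM mulmxA -[invmx N *m _ *m _]mulmxA SS.
  by rewrite mulmxDr mulVmx // mulmxDl mul1mx (mulmxK unitUV) addrC.
have spA : sp A.
  by rewrite /sp /A /= sympl_adjZ sympl_adjB adjiM adjiN -scalerN opprB.
have horH : HorSpSt U H.
  by rewrite /HorSpSt /H /= -scalemxAr mulmxBr -/K UK UU subrr scaler0.
have halfL : 2^-1 *: tildeOmega U L = cay_arg U K (invmx N - invmx M).
  rewrite half_tildeOmega // /A /H !scalerA mulVf // !scale1r.
  by rewrite [U + _]addrC subrK.
have DE : sympl_adj K *m K - (invmx N - invmx M) = 2 *: invmx M.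
  by rewrite KK opprB addrA addrAC addrK scaler_nat.
have defL : cay_defined (2^-1 *: tildeOmega U L).
  rewrite halfL; apply: cay_arg_unit => //.
  by rewrite DE unitmxZ ?unitmx_inv // unitfE.
split=> //.
  by rewrite /TSpSt /L /= mulmxDr mulmxA UU mul1mx (horH : _ = 0) addr0.
apply: cay_mul_eq => //; rewrite halfL.
have -> : V + U = K *m M by rewrite mulmxKV.
rewrite mulmxA cay_arg_mulK // DE mulmxBl -scalemxAr -scalemxAl mulmxKV //.
by rewrite mulmxKV // scaler_nat mulr2n opprD addrA addrK.
Qed.
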